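(* If $G$ is a finite, simple, connected outerplanar graph without isolated vertices, then $\chi^*_{ON}(G)\le 4$.
   Context: A CFON* coloring (partial conflict-free coloring on open neighborhoods) of a graph $G=(V,E)$ using $k$ colors is an assignment $C:V(G)\to\{1,\dots,k,\text{unassigned}\}$ such that for every $v\in V(G)$ (including unassigned vertices) there exists $i\in\{1,\dots,k\}$ with $|N(v)\cap C^{-1}(i)|=1$, where $N(v)$ is the open neighborhood of $v$. $\chi^*_{ON}(G)$ is the smallest $k$ for which such a coloring exists. An outerplanar graph is a planar graph that has a planar drawing in which all vertices belong to the outer face. *)

(* Defs.v *)
From HB Require Import structures.
From mathcomp Require Import all_boot all_order all_algebra.
From mathcomp Require Import boolp classical_sets functions set_interval.
From mathcomp Require Import reals topology normedtype.

Set Implicit Arguments.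
Unset Strict Implicit.
Unset Printing Implicit Defensive.

Import Order.TTheory GRing.Theory Num.Theory numFieldNormedType.Exports.

Record sgraph := SGraph {
  vertex :> finType;
  adj : rel vertex;
  adj_sym : symmetric adj;
  adj_irrefl : irreflexive adj }.

Section Graphs.
Variable G : sgraph.

Definition connected_graph := forall u v : G, connect (@adj G) u v.

Definition open_nbh (v : G) : {set G} := finset (adj v).

Definition no_isolated := forall v : G, open_nbh v != finset.set0.

(* [None] is the value "unassigned". *)
Definition is_cfon (k : nat) (C : {ffun G -> option 'I_k}) : bool :=
  [forall v, exists i : 'I_k,
     #|open_nbh v :&: C @^-1: pred1 (Some i)| == 1%N].

Definition cfon_colorable (k : nat) : bool :=
  [exists C : {ffun G -> option 'I_k}, is_cfon C].

Lemma cfon_colorable_ex : no_isolated -> exists k, cfon_colorable k.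
Proof.
move=> iso; exists #|G|; apply/existsP; exists [ffun v => Some (enum_rank v)].
apply/forallP => v; have /set0Pn[u uv] := iso v.
apply/existsP; exists (enum_rank u); apply/cards1P; exists u.
apply/setP => w; rewrite !inE ffunE.
apply/andP/eqP => [[_ /eqP[/enum_rank_inj]] //|->].
by rewrite eqxx; split=> //; move: uv; rewrite inE.
Qed.

(* A vertex without neighbours admits no valid colour, so the minimum exists
   only for graphs without isolated vertices. *)
Definition chi_ON (iso : no_isolated) : nat := ex_minn (cfon_colorable_ex iso).

End Graphs.

Section Drawings.
Local Open Scope classical_set_scope.
Local Open Scope ring_scope.
Variables (R : realType) (G : sgraph).

(* [arc u v] is only meaningful on the segment [0, 1] and for adjacent [u], [v];
   the arcs [arc u v] and [arc v u] represent the same edge and have the same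
   image. *)
Record planar_drawing := PlanarDrawing {
  pos : G -> R * R;
  arc : G -> G -> R -> R * R;
  pos_inj : injective pos;
  arc_continuous : forall u v, adj u v -> {within `[0, 1], continuous (arc u v)};
  arc_inj : forall u v, adj u v -> {in `[0, 1] &, injective (arc u v)};
  arc_start : forall u v, adj u v -> arc u v 0 = pos u;
  arc_end : forall u v, adj u v -> arc u v 1 = pos v;
  arc_sym : forall u v, adj u v -> arc u v @` `[0, 1] = arc v u @` `[0, 1];
  arc_avoids_vertices : forall u v w, adj u v -> ~ (arc u v @` `]0, 1[) (pos w);
  arc_disjoint : forall u v x y, adj u v -> adj x y ->
    [set u; v]%SET != [set x; y]%SET ->
    arc u v @` `]0, 1[ `&` arc x y @` `]0, 1[ = set0 }.

Definition drawing_set (D : planar_drawing) : set (R * R) :=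
  [set p | exists v, p = pos D v] `|`
  [set p | exists u v, adj u v /\ (arc D u v @` `[0, 1]) p].

Definition is_face (D : planar_drawing) (F : set (R * R)) :=
  exists2 p, (~` drawing_set D) p & F = connected_component (~` drawing_set D) p.

Definition is_outer_face (D : planar_drawing) (F : set (R * R)) :=
  is_face D F /\ ~ bounded_set F.

(* Faces are open, so a vertex "belongs" to a face when it lies on its
   boundary. *)
Definition outerplanar :=
  exists (D : planar_drawing) (F : set (R * R)),
    is_outer_face D F /\ forall v, closure F (pos D v).

End Drawings.

(* Main.v *)
(* An outerplanar graph has no K4 minor.  Given four disjoint connected branch
   sets, pairwise joined by edges, draw each edge ij of K4 inside the union of
   the branch sets i and j, so that disjoint edges of K4 get disjoint drawings,
   and likewise a vertex and the opposite triangle.  This is a map from the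
   deleted product of K4 to the nonzero vectors of the plane.  As every vertex
   lies on the boundary of the unbounded face, no triangle winds around the
   opposite vertex.  Counting modulo 2 how often the vectors x - y cross the
   positive horizontal axis along the boundaries of the products of disjoint
   edges and of the four products of a vertex with the opposite triangle, one
   obtains 0 = 1: this is the topological Radon theorem, with fine chains of
   points in place of the arcs.

   A graph without K4 minor has, by contracting edges with at most one common
   neighbour, fewer than 2n - 2 edges, hence a vertex of degree at most 3;
   contracting it with two nonadjacent neighbours gives a proper 3-colouring by
   induction, for all minors at once.

   Let J be a maximal set such that every vertex has at most one neighbour in J,
   and let S be the set of vertices outside J with a neighbour in J.  Colour J
   with a fourth colour.  By maximality of J every vertex without neighbour in J
   has a neighbour in S; contract it into one such neighbour, and give S the
   colours of a proper 3-colouring of the resulting minor. *)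
From mathcomp Require Import all_boot all_order all_algebra zify lra.
Require Import Defs.

Set Implicit Arguments.
Unset Strict Implicit.
Unset Printing Implicit Defensive.

(** * Minors as families of connected vertex sets *)

Section Blocks.
Variable G : sgraph.
Implicit Types (x y z : G) (X Y Z W : {set G}) (P Q : {set {set G}}).

Definition connected_set X := X != set0 /\ forall x y, x \in X -> y \in X ->
  exists p : seq G, [/\ path (@adj G) x p, last x p = y & {subset x :: p <= X}].

(** Disjointness is built in, so the relation is irreflexive and a block is never its own
    neighbour. *)
Definition adj_blocks X Y :=
  [disjoint X & Y] && [exists x in X, exists y in Y, adj x y].

Lemma adj_blocks_sym : symmetric adj_blocks.
Proof.
move=> X Y; rewrite /adj_blocks disjoint_sym; congr (_ && _).
by apply/exists_inP/exists_inP => -[x Xx /exists_inP[y Yy xy]]; exists y => //;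
  apply/exists_inP; exists x; rewrite // adj_sym.
Qed.

Lemma adj_blocksUr X Y Z : [disjoint X & Y :|: Z] ->
  adj_blocks X (Y :|: Z) = adj_blocks X Y || adj_blocks X Z.
Proof.
move=> dX; have [dXY dXZ] : [disjoint X & Y] /\ [disjoint X & Z].
  by move: dX; rewrite -!setI_eq0 setIUr setU_eq0 => /andP.
rewrite /adj_blocks dX dXY dXZ /=; apply/exists_inP/orP.
  move=> [x Xx /exists_inP[y]]; rewrite inE => /orP[] Yy xy; [left|right];
  by apply/exists_inP; exists x => //; apply/exists_inP; exists y.
by move=> -[] /exists_inP[x Xx /exists_inP[y Yy xy]]; exists x => //;
  apply/exists_inP; exists y => //; rewrite inE Yy ?orbT.
Qed.

Lemma connected_setU X Y : connected_set X -> connected_set Y -> adj_blocks X Y ->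
  connected_set (X :|: Y).
Proof.
wlog suff main : / forall X Y, connected_set X -> connected_set Y -> adj_blocks X Y ->
  forall x y, x \in X -> y \in X :|: Y ->
  exists p : seq G, [/\ path (@adj G) x p, last x p = y & {subset x :: p <= X :|: Y}].
  move=> cX cY XY; split.
    by case: cX => /set0Pn[x Xx] _; apply/set0Pn; exists x; rewrite inE Xx.
  move=> x y /setUP[Xx|Yx] hy; first exact: main.
  by rewrite setUC in hy *; apply: main => //; rewrite adj_blocks_sym.
move=> {}X {}Y [_ cX] [_ cY] /andP[_ /exists_inP[a Xa /exists_inP[b Yb ab]]] x y Xx.
have subX p z : {subset z :: p <= X} -> {subset z :: p <= X :|: Y}.
  by move=> h w /h wX; rewrite inE wX.
move=> /setUP[Xy|Yy].
  by have [p [h1 h2 h3]] := cX x y Xx Xy; exists p; split=> //; exact: subX.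
have [p [p1 p2 p3]] := cX x a Xx Xa; have [q [q1 q2 q3]] := cY b y Yb Yy.
exists (p ++ b :: q); split.
- by rewrite cat_path p1 p2 /= ab.
- by rewrite last_cat.
move=> w; rewrite -cat_cons mem_cat in_setU => /orP[/p3->//|/q3->]; exact: orbT.
Qed.

Definition block_family P :=
  trivIset P /\ forall X, X \in P -> connected_set X.


Lemma adj_blocks_irr X : adj_blocks X X = false.
Proof.
apply/negP => /andP[]; rewrite -setI_eq0 setIid => /eqP->.
by move=> /exists_inP[x]; rewrite inE.
Qed.

(** * The quotient graph on the blocks and its edge contractions *)

Definition nbrs P X := [set Y in P | adj_blocks X Y].

Lemma in_nbrs P X Y : (Y \in nbrs P X) = (Y \in P) && adj_blocks X Y.
Proof. by rewrite inE. Qed.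

(** Twice the number of edges of the graph whose vertices are the blocks in [P]. *)
Definition degree_sum P := \sum_(X in P) #|nbrs P X|.

Lemma nbrsU1 P X Y : X \notin P -> #|nbrs (X |: P) Y| = adj_blocks Y X + #|nbrs P Y|.
Proof.
move=> XP; rewrite /nbrs; case XY: (adj_blocks Y X).
  have -> : [set Z in X |: P | adj_blocks Y Z] = X |: [set Z in P | adj_blocks Y Z].
    by apply/setP => Z; rewrite !inE; case: eqP => [->|] //=.
  by rewrite cardsU1 inE (negbTE XP).
congr (#|pred_of_set _|); apply/setP => Z; rewrite !inE.
by case: eqP => [->|] //=; rewrite XY andbF.
Qed.

Lemma degree_sumU1 P X : X \notin P ->
  degree_sum (X |: P) = degree_sum P + 2 * #|nbrs P X|.
Proof.
move=> XP; rewrite /degree_sum big_setU1 //= nbrsU1 // adj_blocks_irr.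
rewrite (eq_bigr (fun Y => adj_blocks Y X + #|nbrs P Y|)); last first.
  by move=> Y _; rewrite nbrsU1.
rewrite big_split /=.
have -> : \sum_(Y in P) adj_blocks Y X = #|nbrs P X|.
  rewrite -sum1_card [RHS](eq_bigl (fun Y => (Y \in P) && adj_blocks X Y)); last first.
    by move=> Y; rewrite inE.
  rewrite big_mkcondr /=; apply: eq_bigr => Y _.
  by rewrite adj_blocks_sym; case: adj_blocks.
by rewrite add0n addnA addnn -mul2n addnC.
Qed.

(** Contraction of the edge between [X] and [Y] in the graph on the blocks. *)
Definition merge_blocks P X Y := (X :|: Y) |: (P :\ X :\ Y).

Section Merge.
Variables (P : {set {set G}}) (X Y : {set G}).
Hypotheses (famP : block_family P) (XP : X \in P) (YP : Y \in P) (XY : adj_blocks X Y).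

Lemma family_disjoint Z W : Z \in P -> W \in P -> Z != W -> [disjoint Z & W].
Proof. by case: famP => /trivIsetP h _; exact: h. Qed.

Lemma merge_disjoint Z : Z \in P :\ X :\ Y -> [disjoint Z & X :|: Y].
Proof.
rewrite !inE => /and3P[ZY ZX ZP]; rewrite -setI_eq0 setIUr setU_eq0 !setI_eq0.
by rewrite !family_disjoint.
Qed.

Lemma merge_notin : X :|: Y \notin P :\ X :\ Y.
Proof.
apply/negP => h; have := merge_disjoint h; rewrite -setI_eq0 setIid setU_eq0.
by case: famP => _ /(_ _ XP)[/negbTE->].
Qed.

Lemma merge_neq : X != Y.
Proof. by apply/eqP => h; move: XY; rewrite h adj_blocks_irr. Qed.

Lemma mergeE : P = X |: (Y |: (P :\ X :\ Y)).
Proof.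
rewrite setD1K ?setD1K // !inE YP andbT.
by rewrite eq_sym merge_neq.
Qed.

Lemma merge_family : block_family (merge_blocks P X Y).
Proof.
have [_ cP] := famP; split; last first.
  move=> Z /setU1P[->|]; first exact: connected_setU (cP _ XP) (cP _ YP) XY.
  by rewrite !inE => /and3P[_ _ /cP].
apply/trivIsetP => Z W /setU1P[->|hZ] /setU1P[->|hW]; rewrite ?eqxx // => ZW.
- by rewrite disjoint_sym merge_disjoint.
- exact: merge_disjoint.
- by move: hZ hW; rewrite !inE => /and3P[_ _ ?] /and3P[_ _ ?]; exact: family_disjoint.
Qed.

Lemma card_merge : #|P| = #|merge_blocks P X Y|.+1.
Proof.
by rewrite {1}mergeE /merge_blocks !cardsU1 merge_notin !inE !eqxx (negbTE merge_neq).
Qed.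

(** Contraction loses the edge itself and, for each common neighbour, one of two parallel edges;
    every lost edge counts twice. *)
Lemma degree_sum_merge :
  degree_sum P = degree_sum (merge_blocks P X Y) + 2 + 2 * #|nbrs P X :&: nbrs P Y|.
Proof.
set R := P :\ X :\ Y.
have XR : X \notin Y |: R.
  by rewrite !inE eqxx (negbTE merge_neq) andbF.
have YR : Y \notin R by rewrite !inE eqxx.
rewrite {1}mergeE -/R degree_sumU1 // degree_sumU1 // nbrsU1 // XY.
rewrite /merge_blocks -/R degree_sumU1 ?merge_notin //.
have -> : nbrs R (X :|: Y) = nbrs R X :|: nbrs R Y.
  apply/setP => Z; rewrite in_setU !in_nbrs; case ZR: (Z \in R) => //=.
  by rewrite adj_blocks_sym adj_blocksUr ?merge_disjoint // !(adj_blocks_sym Z).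
have -> : nbrs P X :&: nbrs P Y = nbrs R X :&: nbrs R Y.
  apply/setP => Z; rewrite {1 2}mergeE -/R !in_setI !in_nbrs !in_setU1.
  have [->|ZX] /= := eqVneq Z X; first by rewrite adj_blocks_irr !andbF.
  by have [->|ZY] /= := eqVneq Z Y; first by rewrite adj_blocks_irr !andbF.
have := cardsUI (nbrs R X) (nbrs R Y).
by lia.
Qed.

Lemma merge_sub Z : Z \in merge_blocks P X Y -> exists2 W, W \in P & W \subset Z.
Proof.
move=> /setU1P[->|]; first by exists X => //; exact: subsetUl.
by rewrite !inE => /and3P[_ _ ZP]; exists Z.
Qed.

End Merge.

(** * Many edges force a K4 minor *)

Definition K4_minor := exists A B C D : {set G},
  [/\ connected_set A, connected_set B, connected_set C & connected_set D] /\
  [/\ adj_blocks A B, adj_blocks A C & adj_blocks A D] /\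
  [/\ adj_blocks B C, adj_blocks B D & adj_blocks C D].

(** What is kept of being a connected union of blocks of [P]. If some [X] is adjacent to all of [P],
    the block inside [Z] gives an edge from [X] to [Z], and the cover gives their disjointness. *)
Definition coarse_block P Z :=
  [/\ connected_set Z, exists2 W, W \in P & W \subset Z & Z \subset cover P].

Lemma coarse_merge P X Y Z : X \in P -> Y \in P ->
  coarse_block (merge_blocks P X Y) Z -> coarse_block P Z.
Proof.
move=> XP YP [cZ [W WQ WZ] Zcov]; split=> //.
  by have [V VP VW] := merge_sub XP WQ; exists V => //; exact: subset_trans VW WZ.
apply: subset_trans Zcov _; apply/bigcupsP => V /setU1P[->|].
  by rewrite subUset !(bigcup_sup _ (F := id)).
by rewrite !inE => /and3P[_ _ VP]; exact: (bigcup_sup V).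
Qed.

Lemma degree_sum_bound P : degree_sum P <= #|P| * #|P|.-1.
Proof.
rewrite -sum_nat_const; apply: leq_sum => X XP.
rewrite (cardsD1 X P) XP; apply: subset_leq_card; apply/subsetP => Y.
rewrite in_nbrs !inE => /andP[-> XY]; rewrite andbT.
by apply/eqP => YX; rewrite YX adj_blocks_irr in XY.
Qed.

Lemma family_edge P : 0 < degree_sum P ->
  exists X Y, [/\ X \in P, Y \in P & adj_blocks X Y].
Proof.
rewrite lt0n sum_nat_eq0 => /forallPn[X]; rewrite negb_imply => /andP[XP].
by rewrite cards_eq0 => /set0Pn[Y]; rewrite in_nbrs => /andP[YP XY]; exists X, Y.
Qed.

(** There are at least as many edges as blocks. An edge with a common neighbour lies in a triangle;
    contracting an edge without one loses one block and one edge, so the hypothesis survives. *)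
Lemma triangle_of_edges P : block_family P -> 0 < #|P| -> 2 * #|P| <= degree_sum P ->
  exists A B C, [/\ coarse_block P A, coarse_block P B & coarse_block P C] /\
    [/\ adj_blocks A B, adj_blocks A C & adj_blocks B C].
Proof.
have [n] := ubnP #|P|; elim: n P => // n IH P /ltnSE Pn famP P0 dP.
have [|X [Y [XP YP XY]]] := @family_edge P.
  by apply: leq_trans dP; rewrite muln_gt0.
have cP Z : Z \in P -> coarse_block P Z.
  by move=> ZP; split; [exact: famP.2 | exists Z | exact: (bigcup_sup Z)].
have [XY0|/set0Pn[Z]] := eqVneq (nbrs P X :&: nbrs P Y) set0; last first.
  rewrite inE !in_nbrs => /andP[/andP[ZP XZ] /andP[_ YZ]].
  by exists X, Y, Z; split; split=> //; exact: cP.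
have cQ := card_merge famP XP YP XY.
have dQ := degree_sum_merge famP XP YP XY; rewrite XY0 cards0 muln0 addn0 in dQ.
have [||||A [B [C [[hA hB hC] hABC]]]] := IH (merge_blocks P X Y).
- by rewrite -cQ.
- exact: merge_family.
- by rewrite card_gt0; apply/set0Pn; exists (X :|: Y); exact: setU11.
- by move: dP; rewrite dQ cQ mulnS addnC leq_add2r.
by exists A, B, C; split=> //; split; apply: coarse_merge XP YP _.
Qed.

Lemma adj_blocks_subr X Y Z : adj_blocks X Y -> Y \subset Z -> [disjoint X & Z] ->
  adj_blocks X Z.
Proof.
move=> /andP[_ /exists_inP[x Xx /exists_inP[y Yy xy]]] YZ XZ; apply/andP; split=> //.
apply/exists_inP; exists x => //; apply/exists_inP; exists y => //.
exact: (subsetP YZ).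
Qed.

Lemma adj_coarse P X Z : coarse_block (nbrs P X) Z -> adj_blocks X Z.
Proof.
move=> [_ [W] + WZ Zcov]; rewrite in_nbrs => /andP[_ XW].
apply: adj_blocks_subr XW WZ _.
rewrite disjoint_sym; apply: disjointWl Zcov _; rewrite disjoint_sym.
by apply/bigcup_disjointP => V; rewrite in_nbrs => /andP[_ /andP[]].
Qed.

(** The bound means at least 2n - 2 edges on n blocks. Contracting an edge with at most one common
    neighbour loses one block and at most two edges. If no such edge exists, every block in the
    neighbourhood of [X] has two neighbours there, which yields a triangle minor that [X]
    completes. *)
Lemma K4_of_edges P : block_family P -> 1 < #|P| -> 4 * #|P| <= degree_sum P + 4 ->
  K4_minor.
Proof.
have [n] := ubnP #|P|; elim: n P => // n IH P /ltnSE Pn famP P1 dP.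
have [|X [Y [XP YP XY]]] := @family_edge P; first by lia.
have [[Z [W [ZP WP ZW c1]]]|none] :
    (exists Z W, [/\ Z \in P, W \in P, adj_blocks Z W &
      #|nbrs P Z :&: nbrs P W| <= 1]) \/
    (forall Z W, Z \in P -> W \in P -> adj_blocks Z W ->
      1 < #|nbrs P Z :&: nbrs P W|).
- have [/exists_inP[Z ZP /exists_inP[W WP /andP[h1 h2]]]|/exists_inPn none] :=
    boolP [exists Z in P, exists W in P,
      adj_blocks Z W && (#|nbrs P Z :&: nbrs P W| <= 1)].
    by left; exists Z, W.
  right=> Z W ZP WP ZW; have /exists_inPn/(_ W WP) := none Z ZP.
  by rewrite ZW /= ltnNge.
- have cQ := card_merge famP ZP WP ZW.
  have dQ := degree_sum_merge famP ZP WP ZW.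
  apply: (IH (merge_blocks P Z W)); first by rewrite -cQ.
  + exact: merge_family.
  (* The contraction cannot leave a single block: two blocks have degree sum at most 2, but the
     hypothesis asks for 4. *)
  + rewrite ltnNge; apply/negP => Q1; have {}cQ : #|P| = 2.
      by apply/eqP; rewrite eqn_leq P1 andbT cQ ltnS.
    by have := leq_trans dP (leq_add (degree_sum_bound P) (leqnn 4)); rewrite cQ.
  + move: dP; rewrite cQ dQ mulnS; move: c1; case: #|_ :&: _| => [|[|]] //= _;
      by move: #|merge_blocks P Z W| (degree_sum _) => m s; lia.
have famN : block_family (nbrs P X).
  split; last by move=> Z; rewrite in_nbrs => /andP[/famP.2].
  by apply: trivIsetS famP.1; apply/subsetP => Z; rewrite in_nbrs => /andP[].
have [||A [B [C [[hA hB hC] [AB AC BC]]]]] := @triangle_of_edges (nbrs P X) famN.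
- by rewrite card_gt0; apply/set0Pn; exists Y; rewrite in_nbrs YP.
- rewrite mulnC -sum_nat_const; apply: leq_sum => Z; rewrite in_nbrs => /andP[ZP XZ].
  apply: leq_trans (none _ _ XP ZP XZ) (subset_leq_card _).
  by apply/subsetP => W; rewrite in_setI !in_nbrs => /andP[-> /andP[_ ->]].
exists X, A, B, C; split.
  by split; [exact: famP.2 | case: hA | case: hB | case: hC].
by split; split=> //; exact: (@adj_coarse P).
Qed.

(** * Proper 3-colourings of minors *)

Definition proper_on P (c : {set G} -> 'I_3) := forall Y Z,
  Y \in P -> Z \in P -> adj_blocks Y Z -> c Y != c Z.

Lemma proper_extend P X c : proper_on (P :\ X) c -> #|c @: nbrs P X| < 3 ->
  exists c', proper_on P c'.
Proof.
move=> hc small; have /subsetPn[k _ kc] : ~~ ([set: 'I_3] \subset c @: nbrs P X).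
  by apply/negP => /subset_leq_card; rewrite cardsT card_ord leqNgt small.
have kP Y : Y \in P -> adj_blocks X Y -> c Y != k.
  by move=> YP XY; apply: contraNneq kc => <-; apply: imset_f; rewrite in_nbrs YP.
exists (fun Z => if Z == X then k else c Z) => Y Z YP ZP /=.
have [->|YX] := eqVneq Y X; have [->|ZX] := eqVneq Z X; move=> YZ.
- by rewrite adj_blocks_irr in YZ.
- by rewrite eq_sym kP.
- by rewrite kP // adj_blocks_sym.
- by apply: hc; rewrite // !inE ?YX ?ZX.
Qed.

(** [A] and [B] may share the colour of the contracted block [W] because they are not adjacent, and
    a block adjacent to either of them is adjacent to [W]. *)
Lemma proper_unmerge P X A B c : block_family P -> X \in P ->
  A \in nbrs P X -> B \in nbrs P X -> A != B -> ~~ adj_blocks A B ->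
  proper_on (merge_blocks (merge_blocks P X A) (X :|: A) B) c ->
  let W := X :|: A :|: B in
  proper_on (P :\ X) (fun Z => if Z \in [set A; B] then c W else c Z).
Proof.
move=> famP XP; rewrite !in_nbrs => /andP[AP XA] /andP[BP XB] neAB AB.
move=> hc W; have famM := merge_family famP XP AP XA.
have WQ : W \in merge_blocks (merge_blocks P X A) (X :|: A) B by exact: setU11.
have XAM : X :|: A \in merge_blocks P X A by exact: setU11.
have BM : B \in merge_blocks P X A.
  apply: setU1r; rewrite !in_setD1 BP andbT; apply/andP; split.
    by rewrite eq_sym neAB.
  by apply: contraTneq XB => ->; rewrite adj_blocks_irr.
have other Z : Z \in P :\ X -> Z \notin [set A; B] ->
    Z \in merge_blocks P X A :\ (X :|: A) :\ B.
  rewrite in_set2 negb_or => ZPX /andP[ZA ZB].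
  have ZR : Z \in P :\ X :\ A by rewrite in_setD1 ZA.
  rewrite !in_setD1 ZB setU1r //= andbT.
  by apply: contraTneq ZR => ->; exact: merge_notin.
have key Y Z : Y \in [set A; B] -> Z \in P :\ X -> Z \notin [set A; B] ->
    adj_blocks Y Z -> c W != c Z.
  move=> hY ZPX hZ YZ; have ZM := other _ ZPX hZ.
  apply: hc => //; first exact: setU1r.
  move: YZ; rewrite adj_blocks_sym [in X in _ -> X]adj_blocks_sym => YZ.
  apply: adj_blocks_subr YZ _ (merge_disjoint famM XAM BM ZM).
  by case/set2P: hY => ->; rewrite ?subsetUr // /W -setUA setUCA subsetUl.
move=> Y Z YP ZP YZ /=; case: ifPn => hY; case: ifPn => hZ.
- move: hY hZ YZ; rewrite !inE => /orP[]/eqP-> /orP[]/eqP->;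
    by rewrite ?adj_blocks_irr // ?(negbTE AB) // adj_blocks_sym (negbTE AB).
- exact: key YZ.
- by rewrite eq_sym; apply: (key Z Y); rewrite // adj_blocks_sym.
- by apply: hc; rewrite // setU1r // other.
Qed.

(** Take [X] of degree at most 3. If two of its neighbours are nonadjacent, they receive the same
    colour through a contraction. Otherwise the neighbours form a clique, of size at most 2 since
    there is no K4, and [X] is deleted. Either way at most two colours occur around [X]. *)
Lemma three_coloring P : ~ K4_minor -> block_family P -> exists c, proper_on P c.
Proof.
move=> noK4; have [n] := ubnP #|P|; elim: n P => // n IH P /ltnSE Pn famP.
have [->|/set0Pn[X0 X0P]] := eqVneq P set0.
  by exists (fun=> ord0) => Y Z; rewrite inE.
have [X XP degX] : exists2 X, X \in P & #|nbrs P X| <= 3.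
  have [/exists_inP[X XP dX]|/exists_inPn big] :=
    boolP [exists X in P, #|nbrs P X| <= 3].
    by exists X.
  case: noK4; apply: (K4_of_edges famP).
    have := big X0 X0P; rewrite -ltnNge => /leq_trans/(_ (subset_leq_card _)) h.
    by apply: leq_trans (h _ _) => //; apply/subsetP => Y; rewrite in_nbrs => /andP[].
  apply: leq_trans (leq_addr _ _); rewrite mulnC -sum_nat_const.
  by apply: leq_sum => X XP; rewrite ltnNge big.
have subn : nbrs P X \subset P by apply/subsetP => Y; rewrite in_nbrs => /andP[].
have [/exists_inP[A hA /exists_inP[B hB /andP[neAB AB]]]|/exists_inPn clique] :=
  boolP [exists A in nbrs P X, exists B in nbrs P X, (A != B) && ~~ adj_blocks A B].
  have [AP XA] : A \in P /\ adj_blocks X A by apply/andP; rewrite -in_nbrs.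
  have [BP XB] : B \in P /\ adj_blocks X B by apply/andP; rewrite -in_nbrs.
  have famM := merge_family famP XP AP XA.
  have BR : B \in P :\ X :\ A.
    rewrite !inE eq_sym neAB BP andbT /=.
    by apply: contraTneq XB => ->; rewrite adj_blocks_irr.
  have BM : B \in merge_blocks P X A by exact: setU1r.
  have XAB : adj_blocks (X :|: A) B.
    by rewrite adj_blocks_sym adj_blocksUr ?(merge_disjoint famP) // adj_blocks_sym XB.
  have [|c hc] := IH _ _ (merge_family famM (setU11 _ _) BM XAB).
    apply: leq_trans Pn; rewrite (card_merge famP XP AP XA).
    by rewrite (card_merge famM (setU11 _ _) BM XAB) ltnS leqnSn.
  apply: proper_extend (proper_unmerge famP XP hA hB neAB AB hc) _.
  set c1 := fun Z => _.
  (* [A] and [B] share one colour, and at most one further neighbour is left. *)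
  have -> : nbrs P X = A |: (B |: (nbrs P X :\ A :\ B)).
    by rewrite setD1K ?setD1K // !inE eq_sym neAB -in_nbrs.
  rewrite !imsetU1 /c1 !inE !eqxx orbT setUA setUid -/c1.
  apply: leq_ltn_trans (leq_card_setU _ _) _; rewrite cards1 ltnS add1n ltnS.
  apply: leq_trans (leq_imset_card _ _) _.
  move: degX; rewrite (cardsD1 A) hA (cardsD1 B) !inE eq_sym neAB -in_nbrs hB.
  by [].
have famPX : block_family (P :\ X).
  split; first by apply: trivIsetS famP.1; exact: subD1set.
  by move=> Z /setD1P[_ /famP.2].
have [|c hc] := IH (P :\ X) _ famPX; first by rewrite (cardsD1 X) XP in Pn.
apply: proper_extend hc _; apply: leq_ltn_trans (leq_imset_card _ _) _.
rewrite ltnNge; apply/negP => /card_gt2P[A [B [C [[hA hB hC] [AB BC CA]]]]].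
have edge Y Z : Y \in nbrs P X -> Z \in nbrs P X -> Y != Z -> adj_blocks Y Z.
  by move=> hY hZ YZ; have /exists_inPn/(_ Z hZ) := clique Y hY; rewrite YZ negbK.
have bound Y : Y \in nbrs P X -> connected_set Y /\ adj_blocks X Y.
  by rewrite in_nbrs => /andP[/famP.2].
have [[cA XA] [cB XB]] := (bound _ hA, bound _ hB); have [cC XC] := bound _ hC.
apply: noK4; exists X, A, B, C; split.
  by split=> //; exact: famP.2 X XP.
by split; split=> //; apply: edge; rewrite // eq_sym.
Qed.


(** * From 3-colourings of minors to a CFON* colouring *)

Lemma in_open_nbh x y : (y \in open_nbh x) = adj x y.
Proof. by rewrite inE. Qed.

Lemma connected_star x Y : x \in Y -> (forall y, y \in Y -> (y == x) || adj x y) ->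
  connected_set Y.
Proof.
move=> Yx star; split; first by apply/set0Pn; exists x.
have from y : y \in Y -> exists p : seq G,
    [/\ path (@adj G) x p, last x p = y & {subset p <= Y}].
  move=> Yy; have /orP[/eqP->|xy] := star y Yy; first by exists [::].
  by exists [:: y]; rewrite /= xy; split=> // z; rewrite mem_seq1 => /eqP->.
move=> y z Yy /from[p [p1 p2 p3]]; have /orP[/eqP->|xy] := star y Yy.
  by exists p; split=> // w; rewrite in_cons => /orP[/eqP->|/p3].
exists (x :: p); rewrite /= adj_sym xy; split=> // w.
by rewrite !in_cons => /or3P[/eqP->|/eqP->|/p3].
Qed.

(** Adding [v] to a maximal [J] breaks the bound at some [u]; this [u] is adjacent to [v] and
    already has a neighbour in [J]. *)
Lemma maximal_packing : exists J : {set G},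
  (forall v, #|open_nbh v :&: J| <= 1) /\
  forall v, v \notin J -> exists u, adj u v /\ open_nbh u :&: J != set0.
Proof.
pose packing (J : {set G}) := [forall v, #|open_nbh v :&: J| <= 1].
have [|J /maxsetP[/forallP packJ maxJ] _] := @maxset_exists _ packing set0.
  by apply/forallP => v; rewrite setI0 cards0.
exists J; split=> // v vJ.
have : ~~ packing (v |: J).
  by apply: contraNN vJ => /maxJ <-; [exact: setU11 | exact: subsetUr].
rewrite negb_forall => /existsP[u]; rewrite setIUr => big; exists u.
have [uv|/negP uv] := boolP (adj u v); last first.
  case/negP: big; rewrite (_ : open_nbh u :&: [set v] = set0) ?set0U ?packJ //.
  by apply/setP => w; rewrite !inE; apply/negP => /andP[+ /eqP wv]; rewrite wv.
split=> //; apply: contraNneq big => ->; rewrite setU0.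
by apply: leq_trans (subset_leq_card (subsetIr _ _)) _; rewrite cards1.
Qed.

Lemma cfon_colorable4 : ~ K4_minor -> no_isolated G -> cfon_colorable G 4.
Proof.
move=> noK4 iso; have [J [packJ maxJ]] := maximal_packing.
pose hit v := open_nbh v :&: J != set0.
pose S := [set s | (s \notin J) && hit s].
have toS v : ~~ hit v -> exists2 s, s \in S & adj v s.
  move=> nv; have nvJ u : adj v u -> u \notin J.
    move=> vu; apply: contra nv => uJ; apply/set0Pn; exists u.
    by rewrite inE in_open_nbh vu.
  (* If [v] is in [J], each of its neighbours is hit by [v]; otherwise maximality supplies a hit
     neighbour. Neither lies in [J], as [v] is not hit. *)
  have [vJ|vJ] := boolP (v \in J).
    have /set0Pn[u] := iso v; rewrite in_open_nbh => vu; exists u => //.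
    rewrite inE nvJ //=; apply/set0Pn; exists v.
    by rewrite inE in_open_nbh adj_sym vu.
  have [u [uv hu]] := maxJ v vJ; rewrite adj_sym in uv.
  by exists u => //; rewrite inE nvJ.
(* The default [v] never occurs when [v] is not hit, by [toS]. *)
pose f v := odflt v [pick s in S | adj v s].
have fP v : ~~ hit v -> f v \in S /\ adj v (f v).
  move=> /toS[s sS vs]; rewrite /f; case: pickP => [t /andP[]//|].
  by move=> /(_ s); rewrite sS vs.
(* A star with centre [s]. Its other vertices are not hit while the centres are, which makes the
   stars disjoint. *)
pose B s := s |: [set v | ~~ hit v & f v == s].
have BP s v : v \in B s -> v = s \/ ~~ hit v /\ f v = s.
  by rewrite !inE => /orP[/eqP|/andP[? /eqP]]; [left|right].
have hitS s : s \in S -> hit s by rewrite inE => /andP[].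
have disjB s t : s \in S -> t \in S -> s != t -> [disjoint B s & B t].
  move=> /hitS hs /hitS ht st; rewrite -setI_eq0; apply/eqP/setP => v; rewrite in_set0.
  apply/negP => /setIP[/BP[->|[nv fs]] /BP[vt|[nv' ft]]].
  - by rewrite vt eqxx in st.
  - by rewrite hs in nv'.
  - by rewrite vt ht in nv.
  - by rewrite -fs -ft eqxx in st.
have famB : block_family (B @: S).
  split; last first.
    move=> _ /imsetP[s sS ->]; apply: (@connected_star s); first exact: setU11.
    move=> v /BP[->|[/fP[_ +] fs]]; first by rewrite eqxx.
    by rewrite fs adj_sym => ->; rewrite orbT.
  apply/trivIsetP => _ _ /imsetP[s sS ->] /imsetP[t tS ->] BsBt.
  by apply: disjB => //; apply: contraNneq BsBt => ->.
have [c hc] := three_coloring noK4 famB.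
(* [ord_max] is the fourth colour, and [lift ord_max] embeds the three others. *)
pose C := [ffun v : G => if v \in J then Some (ord_max : 'I_4)
  else if v \in S then Some (lift ord_max (c (B v))) else None].
apply/existsP; exists C; apply/forallP => v; apply/existsP.
have [hv|nv] := boolP (hit v).
  exists ord_max; rewrite eqn_leq card_gt0; apply/andP; split.
    apply: leq_trans (packJ v); apply: subset_leq_card; apply/subsetP => w.
    rewrite !inE ffunE => /andP[-> /=]; case: ifP => //= _; case: ifP => //= _.
    by rewrite (inj_eq Some_inj) eq_sym (negbTE (neq_lift _ _)).
  have /set0Pn[w /setIP[vw wJ]] := hv.
  by apply/set0Pn; exists w; rewrite inE vw inE ffunE wJ /=.
have [fS vf] := fP v nv; exists (lift ord_max (c (B (f v)))).
apply/cards1P; exists (f v).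
apply/setP => w; rewrite in_set1 in_setI in_open_nbh !inE ffunE.
apply/andP/eqP => [[vw]|->]; last first.
  have /negbTE fJ : f v \notin J by move: fS; rewrite inE => /andP[].
  by rewrite vf fJ fS.
case: ifP => wJ.
  by rewrite (inj_eq Some_inj) (negbTE (neq_lift _ _)).
case: ifP => // wS; rewrite (inj_eq Some_inj) (inj_eq lift_inj) => cc.
(* A second neighbour [w] of [v] in [S] has another colour: [v] lies in the star of [f v], so the
   edge from [w] to [v] makes the two stars adjacent. *)
apply/eqP; apply: contraTT cc => wf; apply: hc; try exact: imset_f.
apply/andP; split; first exact: disjB.
apply/exists_inP; exists w; first exact: setU11.
apply/exists_inP; exists v; last by rewrite adj_sym.
by rewrite !inE nv eqxx orbT.
Qed.

End Blocks.

(** * Crossing parity of fine chains in the plane *)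

From mathcomp Require Import boolp classical_sets set_interval.
From mathcomp Require Import reals prodnormedzmodule topology normedtype.
Require Import Defs.
Import Order.TTheory GRing.Theory Num.Theory numFieldNormedType.Exports.

Section CrossingParity.
Local Open Scope classical_set_scope.
Local Open Scope ring_scope.
Variable R : realType.
Implicit Types (x y z a b : R * R) (d : R) (s : seq (R * R)).

(* The positive horizontal axis is included, so that exactly one of z and - z
   is in the upper half plane when z != 0. *)
Definition upper z := (0 < z.2) || (z.2 == 0) && (0 < z.1).

(* For a and b close to each other and far from 0 this says that the segment
   from a to b crosses the positive horizontal axis: if the half plane changes,
   then a is close to the horizontal axis, on the side given by a.1. *)
Definition crossing a b := (upper a (+) upper b) && (0 < a.1).

Definition far d z := d <= `|z.1| \/ d <= `|z.2|.

Definition near_pt d a b := `|a.1 - b.1| < d /\ `|a.2 - b.2| < d.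

Lemma far_neq0 d z : 0 < d -> far d z -> z != 0.
Proof.
by move=> d0 h; apply/eqP => z0; move: h; rewrite /far z0 !normr0 leNgt d0 => -[].
Qed.

Lemma upperN z : z != 0 -> upper (- z) = ~~ upper z.
Proof.
rewrite /upper -[z != 0]/(~~ ((z.1 == 0) && (z.2 == 0))).
case: z => u v /=; rewrite oppr_gt0 oppr_eq0 oppr_gt0.
by case: (ltgtP v 0) => //= v0; case: (ltgtP u 0) => //= u0.
Qed.

Lemma upper_change d a b : near_pt d a b -> upper a (+) upper b -> `|a.2| < d.
Proof.
case: a b => [a1 a2] [b1 b2]; rewrite /upper /near_pt /= => -[_ h].
move: h; rewrite !ltr_norml => /andP[h1 h2].
by case: (ltgtP a2 0) => a20; case: (ltgtP b2 0) => b20 //=;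
  rewrite ?addbF ?addbT ?andbF //= => _; lra.
Qed.

(** If both half planes meet [Q], some point of [Q] is near the horizontal axis, hence far from 0 in
    the first coordinate, and all of [Q] lies on the same side. The bit [c] is that side, so on [Q]
    crossing is a coboundary. *)
Lemma cluster d (Q : set (R * R)) :
  (forall a, Q a -> far (d + d) a) -> (forall a b, Q a -> Q b -> near_pt d a b) ->
  exists c, forall a b, Q a -> Q b -> crossing a b = c && (upper a (+) upper b).
Proof.
move=> Qfar Qnear.
have [[[a b] [/= Qa Qb ab]]|none] :=
    pselect (exists p, [/\ Q p.1, Q p.2 & upper p.1 (+) upper p.2]); last first.
  exists false => a b Qa Qb; rewrite /crossing /=.
  by apply/negP => /andP[ab _]; apply: none; exists (a, b).
exists (0 < a.1) => x y Qx Qy; rewrite /crossing andbC.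
have ha := upper_change (Qnear _ _ Qa Qb) ab.
have [h1 _] := Qnear _ _ Qa Qx.
have [ha1|] := Qfar _ Qa; last by have := normr_ge0 a.2; lra.
congr (_ && _); move: h1; rewrite ltr_norml => /andP[h1 h2].
by move: ha1; rewrite ler_normr => /orP[] ha1; apply/idP/idP; lra.
Qed.

Fixpoint parity (g : R * R -> R * R) x s :=
  if s is y :: s' then crossing (g x) (g y) (+) parity g y s' else false.

Fixpoint chain d (K : set (R * R)) x s : Prop :=
  K x /\ (if s is y :: s' then ball x d y /\ chain d K y s' else True).


Lemma farB d x y : ~ ball x d y -> far d (x - y).
Proof.
move=> h; rewrite /far /=; case: (leP d `|x.1 - y.1|) => h1; [by left|right].
by rewrite leNgt; apply/negP => h2; apply: h; split.
Qed.

Lemma nearB d x x' y y' : ball x d x' -> ball y d y' ->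
  near_pt (d + d) (x - y) (x' - y').
Proof.
case=> /= h1 h2 [/= h3 h4]; move: h1 h2 h3 h4.
rewrite -!ball_normE /= /near_pt /= !ltr_norml.
move=> /andP[? ?] /andP[? ?] /andP[? ?] /andP[? ?].
by split; apply/andP; split; lra.
Qed.

Definition apart d (K L : set (R * R)) := forall x y, K x -> L y -> ~ ball x d y.

(** The boundary of a small square in the product is crossed an even number of times, because the
    four differences form a cluster. They are within [d + d] of each other, which is why distance
    [d *+ 4] is required. *)
Lemma crossing_square d x x' y y' : 0 < d -> ball x d x' -> ball y d y' ->
  apart (d *+ 4) [set x; x'] [set y; y'] ->
  crossing (x - y) (x' - y) (+) crossing (x - y') (x' - y') =
  crossing (x - y) (x - y') (+) crossing (x' - y) (x' - y').
Proof.
move=> d0 hx hy h.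
pose Q : set (R * R) := [set z |
  exists a b, [/\ [set x; x'] a, [set y; y'] b & z = a - b]].
have [||c hc] := @cluster (d + d) Q.
- move=> _ [a [b [ha hb ->]]]; apply: farB.
  by have := h _ _ ha hb; rewrite !mulrS mulr0n addr0 !addrA.
- have bx a a' : [set x; x'] a -> [set x; x'] a' -> ball a d a'.
    by move=> /= [->|->] [->|->] //; try (exact: ballxx); apply: ball_sym.
  have b_y b b' : [set y; y'] b -> [set y; y'] b' -> ball b d b'.
    by move=> /= [->|->] [->|->] //; try (exact: ballxx); apply: ball_sym.
  move=> _ _ [a [b [ha hb ->]]] [a' [b' [ha' hb' ->]]].
  by apply: nearB; [exact: bx | exact: b_y].
have Q1 : Q (x - y) by exists x, y; split; [left|left|].
have Q2 : Q (x' - y) by exists x', y; split; [right|left|].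
have Q3 : Q (x - y') by exists x, y'; split; [left|right|].
have Q4 : Q (x' - y') by exists x', y'; split; [right|right|].
rewrite !hc //; case: c {hc} => //=.
by case: (upper _); case: (upper _); case: (upper _); case: (upper _).
Qed.

(** A change of half plane happens across exactly one of the positive and the negative axis, and
    negation exchanges the two. *)
Lemma crossingN d a b : 0 < d -> far (d + d) a -> far (d + d) b -> near_pt d a b ->
  crossing (- a) (- b) = crossing a b (+) (upper a (+) upper b).
Proof.
move=> d0 ha hb hab; have d20 : 0 < d + d by lra.
rewrite /crossing !upperN ?(far_neq0 d20) // addNb addbN negbK.
have := upper_change hab; case: (upper a (+) upper b) => //= /(_ isT) h2.
case: ha => h1; last by lra.
have a10 : a.1 != 0 by rewrite -normr_gt0; lra.
by rewrite oppr_gt0 addbT -leNgt lt_neqAle a10.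
Qed.

Lemma chain_first d K x s : chain d K x s -> K x.
Proof. by case: s => [|y s] []. Qed.

Lemma chain_last d K x s : chain d K x s -> K (last x s).
Proof. by elim: s x => [|y s IH] x [Kx] //= [_ /IH]. Qed.

Lemma chain_cat d K x s t :
  chain d K x s -> chain d K (last x s) t -> chain d K x (s ++ t).
Proof.
by elim: s x => //= y s IH x [Kx [xy h]] ht; do 2![split=> //]; exact: IH.
Qed.

Lemma sub_chain d K L x s : (K `<=` L)%classic -> chain d K x s -> chain d L x s.
Proof.
move=> KL; elim: s x => [|y s IH] x [Kx h]; split; try exact: KL.
  by [].
by case: h => h1 h2; split=> //; exact: IH.
Qed.

Lemma parity_cat g x s t : parity g x (s ++ t) = parity g x s (+) parity g (last x s) t.
Proof. by elim: s x => //= y s IH x; rewrite IH addbA. Qed.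

(** Adding up the small squares along the chain, the inner sides cancel. *)
Lemma parity_strip d K x s y y' : 0 < d -> chain d K x s -> ball y d y' ->
  apart (d *+ 4) K [set y; y'] ->
  parity (fun z => z - y) x s (+) parity (fun z => z - y') x s =
  crossing (x - y) (x - y') (+) crossing (last x s - y) (last x s - y').
Proof.
move=> d0 + hy hK; elim: s x => [|x' s IH] x; first by rewrite /= addbb.
move=> [Kx [xx' hs]] /=; rewrite addbACA IH // addbA; congr (_ (+) _).
rewrite (crossing_square (d := d)) //.
  by rewrite -addbA addbb addbF.
by move=> a b /= [->|->] hb; apply: hK => //; exact: chain_first hs.
Qed.

(** A discrete Stokes formula modulo 2: the boundary of the product of two chains is the sum of its
    strips. *)
Lemma parity_square d K L x s y t : 0 < d -> chain d K x s -> chain d L y t ->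
  apart (d *+ 4) K L ->
  parity (fun z => z - y) x s (+) parity (fun z => z - last y t) x s =
  parity (fun z => x - z) y t (+) parity (fun z => last x s - z) y t.
Proof.
move=> d0 hs + hKL; elim: t y => [|y' t IH] y; first by rewrite /= addbb.
move=> [Ly [yy' ht]] /=; rewrite addbACA -IH //.
rewrite -(parity_strip (d := d) (K := K)) //.
  by rewrite addbA addbK.
by move=> a b Ka [->|->]; apply: hKL => //; exact: chain_first ht.
Qed.

Lemma parityN d L x y t : 0 < d -> chain d L y t -> apart (d *+ 4) [set x] L ->
  parity (fun z => x - z) y t =
  parity (fun z => z - x) y t (+) (upper (y - x) (+) upper (last y t - x)).
Proof.
move=> d0 + hL; elim: t y => [|y' t IH] y; first by rewrite /= addbb.
move=> [Ly [yy' ht]] /=; rewrite IH // -[x - y]opprB -[x - y']opprB.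
have apartL z : L z -> far (d + d + (d + d)) (z - x).
  move=> Lz; apply: farB => /ball_sym h; apply: (hL x z) => //.
  by rewrite !mulrS mulr0n addr0 !addrA in h *.
rewrite (@crossingN (d + d)).
- by do 3![case: (upper _)]; case: (crossing _ _); case: (parity _ _ _).
- by lra.
- exact: apartL.
- by apply: apartL; exact: chain_first ht.
- by apply: nearB => //; exact: ballxx.
Qed.


End CrossingParity.

(** * Linking of compact sets with points of the plane *)

Section PlaneSets.
Local Open Scope classical_set_scope.
Local Open Scope ring_scope.
Variable R : realType.
Implicit Types (x y z a b p : R * R) (d e : R) (s t : seq (R * R)) (K L : set (R * R)).

Lemma le_chain d e K x s : d <= e -> chain d K x s -> chain e K x s.
Proof.
move=> de; elim: s x => [|y s IH] x //= [Kx [xy h]].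
by split=> //; split; [exact: le_ball xy | exact: IH].
Qed.

Lemma le_apart d e K L : d <= e -> apart e K L -> apart d K L.
Proof. by move=> de h x y Kx Ly /(le_ball de); exact: h. Qed.

Lemma apart_closed p K : closed K -> ~ K p -> exists2 d, 0 < d & apart d [set p] K.
Proof.
move=> Kcl nKp; have : nbhs p (~` K).
  by apply: open_nbhs_nbhs; split=> //; apply: closed_openC.
move=> /nbhs_ballP[d /= d0 h]; exists d => // x y -> Ky /h; exact.
Qed.

Lemma apart_compact K L : compact K -> closed L -> K `&` L = set0 ->
  exists2 d, 0 < d & apart d K L.
Proof.
move=> /compact_near_coveringP Kc Lcl KL0.
have : \forall d \near 0^'+, forall x, K x -> apart d [set x] L.
  suff: \forall d \near 0^'+, K `<=` (fun x => apart d [set x] L) by [].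
  apply: Kc => x Kx.
  have [|e e0 he] := @apart_closed x L Lcl.
    by move=> Lx; have : set0 x by rewrite -KL0.
  exists (ball x (e / 2), [set d | d < e / 2]) => /=.
    by split; [exact: nbhsx_ballx (divr_gt0 _ _) | exact: nbhs_right_lt (divr_gt0 _ _)].
  move=> [z d] /= [xz de] a y -> Ly zy; apply: (he x y) => //.
  rewrite [e]splitr; apply: ball_triangle xz _.
  by apply: le_ball zy; exact: ltW.
move=> h; near (0 : R)^'+ => d; exists d => //.
by move=> x y Kx Ly; apply: (near h d) => //.
Unshelve. all: by end_near. Qed.

(** The points of [K] satisfying [P] are relatively open and relatively closed in [K]. *)
Lemma connected_locally_constant (T : pseudoMetricType R) (K P : set T) (x y : T) :
  connected K ->
  (forall u : T, K u ->
    exists2 e, 0 < e & forall v : T, K v -> ball u e v -> P u <-> P v) ->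
  K x -> K y -> P x -> P y.
Proof.
move=> Kconn locP Kx Ky Px.
have nbhsP (u : T) : K u -> nbhs u [set v | K v -> P u <-> P v].
  move=> /[dup] Kz /locP[e e0 h]; apply/nbhs_ballP; exists e => // v /= uv Kz'.
  exact: h.
suff KP : K `&` P = K by move: Ky; rewrite -KP => -[].
apply: Kconn; first by exists x.
- exists (interior (~` K `|` P)); first exact: open_interior.
  apply/seteqP; split=> u [Kz].
    move=> Pz; split=> //; apply: filterS (nbhsP u Kz) => w /= h.
    by case: (pselect (K w)) => [/h[+ _]|]; [move=> /(_ Pz); right | left].
  by move=> /nbhs_singleton[].
- exists (~` interior (~` K `|` ~` P)); first exact/open_closedC/open_interior.
  apply/seteqP; split=> u [Kz].
    by move=> Pz; split=> // /nbhs_singleton[].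
  move=> nz; split=> //; apply: contrapT => nPz; apply: nz.
  apply: filterS (nbhsP u Kz) => w /= h.
  by case: (pselect (K w)) => [/h[_ h']|]; [right => /h' | left].
Qed.

Lemma connected_chain K x y d : connected K -> K x -> K y -> 0 < d ->
  exists2 s, chain d K x s & last x s = y.
Proof.
move=> Kconn Kx Ky d0.
pose P := [set z | exists2 s, chain d K x s & last x s = z].
have stepP z z' : K z' -> ball z d z' -> P z -> P z'.
  move=> Kz' zz' [s hs ls]; exists (rcons s z'); last by rewrite last_rcons.
  rewrite -cats1; apply: chain_cat => //; rewrite ls /=; split=> //.
  by rewrite -ls; exact: chain_last hs.
apply: (@connected_locally_constant _ K P x) => //; last by exists [::].
by move=> z Kz; exists d => // z' Kz' zz'; split; apply: stepP => //; exact: ball_sym.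
Qed.

(* Closed chains in K wind an even number of times around p; comparing two chains
   with the same ends avoids reversing chains. *)
Definition unlinked K p := exists2 d, 0 < d & forall x s t,
  chain d K x s -> chain d K x t -> last x s = last x t ->
  parity (fun z => z - p) x s = parity (fun z => z - p) x t.

Lemma sub_unlinked K L p : K `<=` L -> unlinked L p -> unlinked K p.
Proof.
by move=> KL [d d0 h]; exists d => // x s t hs ht; apply: h; exact: sub_chain KL _.
Qed.

(** Moving the point changes the parity of a chain only by terms at its two ends, which are equal
    for chains with the same ends. *)
Lemma unlinked_local K p : closed K -> ~ K p ->
  exists2 e, 0 < e & forall q, ball p e q -> unlinked K p <-> unlinked K q.
Proof.
move=> Kcl nKp; have [e e0 he] := apart_closed Kcl nKp.
(* The strip formula needs four times the step as distance to both [p] and [q]; this is [e / 2], and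
   the other half absorbs the move from [p] to [q]. *)
have e80 : 0 < e / 8 by lra.
exists (e / 8) => // q pq.
have apq : apart (e / 8 *+ 4) K [set p; q].
  move=> x y Kx hy xy; apply: (he p x) => //; apply: ball_sym.
  have -> : e = e / 8 *+ 4 + e / 2 by rewrite -mulr_natr; lra.
  apply: ball_triangle xy _.
  by case: hy => ->; [apply: ballxx; lra | apply: ball_sym; apply: le_ball pq; lra].
suff same d x s t : 0 < d -> d <= e / 8 -> chain d K x s -> chain d K x t ->
    last x s = last x t ->
  parity (fun z => z - p) x s (+) parity (fun z => z - q) x s =
  parity (fun z => z - p) x t (+) parity (fun z => z - q) x t.
  by split=> -[d d0 h]; (exists (Num.min d (e / 8)); first by rewrite lt_min d0);
    move=> x s t hs ht st;
    (have /= := h _ _ _ (le_chain _ hs) (le_chain _ ht) st);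
    (rewrite ge_min lexx => /(_ isT isT));
    (have := same _ _ _ _ _ _ hs ht st);
    (rewrite lt_min d0 e80 ge_min lexx orbT => /(_ isT isT));
    do 4![case: (parity _ _ _)].
move=> d0 de hs ht st.
by rewrite !(parity_strip (d := e / 8) (K := K)) ?st //; exact: le_chain de _.
Qed.

Lemma parity_const c K p d x s :
  (forall a b, K a -> K b ->
    crossing (a - p) (b - p) = c && (upper (a - p) (+) upper (b - p))) ->
  chain d K x s ->
  parity (fun z => z - p) x s = c && (upper (x - p) (+) upper (last x s - p)).
Proof.
move=> hc; elim: s x => [|y s IH] x /=; first by rewrite addbb andbF.
move=> [Kx [_ hs]]; rewrite IH // hc //; last exact: chain_first hs.
by case: c {hc IH} => //=; do 3![case: (upper _)].
Qed.

(** With [p] beyond [K] on the right no change of half plane is a crossing, on the left every change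
    is one, and above or below [K] there is no change. In each case the parity depends only on the
    ends. *)
Lemma unlinked_far K p (M : R) :
  (forall x, K x -> `|x.1| <= M /\ `|x.2| <= M) -> M < `|p.1| \/ M < `|p.2| ->
  unlinked K p.
Proof.
move=> KM Mp; exists 1 => // x s t hs ht st.
suff [c hc] : exists c, forall a b, K a -> K b ->
    crossing (a - p) (b - p) = c && (upper (a - p) (+) upper (b - p)).
  by rewrite (parity_const hc hs) (parity_const hc ht) st.
have {}KM a : K a -> [/\ a.1 <= M, - a.1 <= M, a.2 <= M & - a.2 <= M].
  by move=> /KM[]; rewrite !ler_norml => /andP[h1 h2] /andP[h3 h4]; split; lra.
move: Mp; rewrite !ltr_normr => -[] /orP[] h.
- exists false => a b /KM[h1 _ _ _] _; rewrite /crossing /=.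
  by rewrite (_ : (0 < a.1 - p.1) = false) ?andbF //; apply/negbTE; rewrite -leNgt; lra.
- exists true => a b /KM[_ h1 _ _] _; rewrite /crossing /=.
  by rewrite (_ : 0 < a.1 - p.1) ?andbT //; lra.
- have up z : K z -> upper (z - p) = false.
    move=> /KM[_ _ h1 _]; have h2 : z.2 - p.2 < 0 by lra.
    by rewrite /upper /= (lt_eqF h2) (lt_gtF h2).
  by exists false => a b Ka Kb; rewrite /crossing !up.
- have up z : K z -> upper (z - p).
    by move=> /KM[_ _ _ h1]; rewrite /upper /= (_ : 0 < z.2 - p.2) //; lra.
  by exists false => a b Ka Kb; rewrite /crossing !up.
Qed.

(** Being unlinked is locally constant off [K], so it passes from a far point of [F] along [F] to a
    point close to [p], and then to [p]. *)
Lemma unlinked_unbounded K F p : compact K -> connected F -> ~ bounded_set F ->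
  F `&` K = set0 -> closure F p -> ~ K p -> unlinked K p.
Proof.
move=> Kc Fconn Funb FK0 Fp nKp.
have Kcl : closed K by apply: compact_closed => //; exact: norm_hausdorff.
have nK q : F q -> ~ K q by move=> Fq Kq; have : set0 q by rewrite -FK0.
have [e e0 he] := unlinked_local Kcl nKp.
have [q [Fq pq]] := Fp _ (nbhsx_ballx _ _ e0).
apply/(he _ pq).
have /compact_bounded[M [_ hM]] := Kc.
(* [hM] only covers bounds strictly above [M], hence [M + 1]. *)
have [r Fr rM] : exists2 r, F r & M + 1 < `|r : (R * R : normedModType R)|.
  apply: contrapT => h; apply: Funb; exists (M + 1); split; first exact: num_real.
  move=> B MB r Fr /=; apply: (le_trans _ (ltW MB)).
  by rewrite leNgt; apply/negP => rM; apply: h; exists r.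
apply: (@connected_locally_constant _ F (unlinked K) r) => //.
  move=> z /nK nKz; have [e' e'0 h] := unlinked_local Kcl nKz.
  by exists e' => // z' _; exact: h.
move: rM; rewrite prod_normE lt_max => /orP rM.
apply: unlinked_far rM => x Kx; apply/andP; rewrite -ge_max -prod_normE.
by apply: (hM (M + 1)) => //; lra.
Qed.

(** Chains of every mesh replace an arc from [x] to [y]. *)
Definition joined K x y := forall d, 0 < d -> exists2 s, chain d K x s & last x s = y.

Lemma joined_trans K x y z : joined K x y -> joined K y z -> joined K x z.
Proof.
move=> jxy jyz d d0; have [s hs ls] := jxy d d0; have [t ht lt] := jyz d d0.
by exists (s ++ t); [apply: chain_cat; rewrite ?ls | rewrite last_cat ls].
Qed.

Lemma sub_joined K L x y : K `<=` L -> joined K x y -> joined L x y.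
Proof.
move=> KL jK d d0; have [s hs ls] := jK d d0.
by exists s => //; exact: sub_chain hs.
Qed.

Lemma unlinked_near K p : unlinked K p -> \forall d \near 0^'+, forall x s t,
  chain d K x s -> chain d K x t -> last x s = last x t ->
  parity (fun z => z - p) x s = parity (fun z => z - p) x t.
Proof.
move=> [e e0 h]; near=> d; have de : d <= e by near: d; exact: nbhs_right_le.
by move=> x s t hs ht; apply: h; exact: le_chain de _.
Unshelve. all: by end_near. Qed.

(** This is the Stokes formula for the product of two chains, with [x - z] turned into [z - x]; each
    such reversal leaves the half plane terms of the corners on the right. *)
Lemma square_near K L : compact K -> compact L -> K `&` L = set0 ->
  \forall d \near 0^'+, forall x s y t, chain d K x s -> chain d L y t ->
    let x' := last x s in let y' := last y t in
    parity (fun z => z - y) x s (+) parity (fun z => z - y') x s (+)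
    (parity (fun z => z - x) y t (+) parity (fun z => z - x') y t) =
    upper (y - x) (+) upper (y' - x) (+) (upper (y - x') (+) upper (y' - x')).
Proof.
move=> Kc Lc KL0.
have [e e0 he] := apart_compact Kc (compact_closed (@norm_hausdorff _ _) Lc) KL0.
near=> d => x s y t hs ht /=.
have d0 : 0 < d by [].
have hd : apart (d *+ 4) K L.
  apply: le_apart he; rewrite -mulr_natr -ler_pdivlMr //.
  by near: d; apply: nbhs_right_le; rewrite divr_gt0.
have apart1 z : K z -> apart (d *+ 4) [set z] L by move=> Kz u v ->; exact: hd.
rewrite (parity_square d0 hs ht hd) (parityN d0 ht (apart1 _ (chain_first hs))).
rewrite (parityN d0 ht (apart1 _ (chain_last hs))).
by do 2![case: (parity _ _ _)]; do 4![case: (upper _)].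
Unshelve. all: by end_near. Qed.

(** The three products of opposite edges of K4 are summed modulo 2. The edge terms regroup into the
    four triangles, each seen from the opposite vertex, and vanish; the half plane terms add up to
    1. *)
Lemma planar_radon (a b c d : R * R) (Kab Kac Kad Kbc Kbd Kcd : set (R * R)) :
  joined Kab a b -> joined Kac a c -> joined Kad a d ->
  joined Kbc b c -> joined Kbd b d -> joined Kcd c d ->
  compact Kab -> compact Kac -> compact Kad ->
  compact Kbc -> compact Kbd -> compact Kcd ->
  Kab `&` Kcd = set0 -> Kac `&` Kbd = set0 -> Kad `&` Kbc = set0 ->
  unlinked (Kab `|` Kbc `|` Kac) d -> unlinked (Kab `|` Kbd `|` Kad) c ->
  unlinked (Kac `|` Kcd `|` Kad) b -> unlinked (Kbc `|` Kcd `|` Kbd) a -> False.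
Proof.
move=> jab jac jad jbc jbd jcd cab cac cad cbc cbd ccd Iabcd Iacbd Iadbc.
move=> /unlinked_near Ud /unlinked_near Uc /unlinked_near Ub /unlinked_near Ua.
have {Ud Uc Ub Ua} := @filter_ex _ (0 : R)^'+ _ _
  (filterI (filterI (filterI Ud Uc) (filterI Ub Ua))
  (filterI (filterI (square_near cab ccd Iabcd) (square_near cac cbd Iacbd))
    (filterI (square_near cad cbc Iadbc) (nbhs_right_gt (0 : R))))).
move=> [e [[[Ud Uc] [Ub Ua]] [[Sabcd Sacbd] [Sadbc e0]]]].
have [ab hab lab] := jab e e0; have [ac hac lac] := jac e e0.
have [ad had lad] := jad e e0; have [bc hbc lbc] := jbc e e0.
have [bd hbd lbd] := jbd e e0; have [cd hcd lcd] := jcd e e0.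
have neq x y K L : K x -> L y -> K `&` L = set0 -> x - y != 0.
  move=> Kx Ly KL0; rewrite subr_eq0; apply/eqP => xy.
  by have : set0 x by rewrite -KL0; split=> //; rewrite xy.
have Kbb : Kab b by rewrite -lab; exact: chain_last hab.
have Kbb' : Kbd b by exact: chain_first hbd.
have Kcc : Kcd c by exact: chain_first hcd.
have Kcc' : Kac c by rewrite -lac; exact: chain_last hac.
have Kdd : Kcd d by rewrite -lcd; exact: chain_last hcd.
(* In the sum of the corner terms the differences with [a] cancel in pairs, while those among [b],
   [c], [d] occur once with each sign and so contribute 1 per pair. *)
have cb : upper (c - b) = ~~ upper (b - c).
  by rewrite -upperN ?opprB //; exact: neq Iabcd.
have db : upper (d - b) = ~~ upper (b - d).
  by rewrite -upperN ?opprB //; exact: neq Iabcd.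
have dc : upper (d - c) = ~~ upper (c - d).
  rewrite -upperN ?opprB // -[c - d]opprB oppr_eq0.
  by apply: (neq _ _ Kbd Kac) => //; rewrite 1?setIC // -lbd; exact: chain_last hbd.
have loop K L M p x y s t u : (forall x s t, chain e (K `|` L `|` M) x s ->
    chain e (K `|` L `|` M) x t -> last x s = last x t ->
    parity (fun z => z - p) x s = parity (fun z => z - p) x t) ->
    chain e K x s -> last x s = y -> chain e L y t -> chain e M x u ->
    last y t = last x u ->
  parity (fun z => z - p) x s (+) parity (fun z => z - p) y t =
  parity (fun z => z - p) x u.
  move=> hU hs ls ht hu tu; rewrite -{1}ls -parity_cat.
  apply: hU; last by rewrite last_cat ls.
    apply: chain_cat; first by apply: sub_chain hs => z Kz; left; left.
    by rewrite ls; apply: sub_chain ht => z Lz; left; right.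
  by apply: sub_chain hu => z Mz; right.
have := loop _ _ _ _ _ _ _ _ _ Ud hab lab hbc hac.
have := loop _ _ _ _ _ _ _ _ _ Uc hab lab hbd had.
have := loop _ _ _ _ _ _ _ _ _ Ub hac lac hcd had.
have := loop _ _ _ _ _ _ _ _ _ Ua hbc lbc hcd hbd.
have := Sabcd _ _ _ _ hab hcd.
have := Sacbd _ _ _ _ hac hbd.
have := Sadbc _ _ _ _ had hbc.
rewrite /= lab lac lad lbc lbd lcd.
move=> S1 S2 S3 Ea Eb Ec Ed; have := f_equal2 addb (f_equal2 addb S1 S2) S3.
rewrite -Ea // -Eb // -Ec // -Ed // cb db dc.
rewrite [LHS](_ : _ = false); last by do 8![case: (parity _ _ _)].
by rewrite [RHS](_ : _ = true) //; do 6![case: (upper _)].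
Qed.

End PlaneSets.

(** * Drawings of vertex sets *)

Section Sketch.
Local Open Scope classical_set_scope.
Local Open Scope ring_scope.
Variables (R : realType) (G : sgraph) (D : planar_drawing R G).
Implicit Types (u v w : G) (X Y : {set G}) (p : R * R).

Definition edge_curve (uv : G * G) : set (R * R) := arc D uv.1 uv.2 @` `[0, 1].

(** The drawing of the subgraph induced by [X]; the vertices are listed separately since they need
    not lie on an edge inside [X]. *)
Definition sketch X : set (R * R) :=
  \bigcup_(v in [set` X]) [set pos D v] `|`
  \bigcup_(uv in [set` [pred uv : G * G | [&& uv.1 \in X, uv.2 \in X & adj uv.1 uv.2]]])
    edge_curve uv.

Lemma sketch_compact X : compact (sketch X).
Proof.
rewrite /sketch !bigcup_pred; apply: compactU; apply: bigsetU_compact.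
  by move=> v _; exact: compact_set1.
move=> [u v] /and3P[_ _ uv].
by apply: continuous_compact; [exact: arc_continuous | exact: segment_compact].
Qed.

Lemma subset_sketch X Y : X \subset Y -> sketch X `<=` sketch Y.
Proof.
move=> /fintype.subsetP XY p [[v /= /XY Yv pv]|].
  by left; exists v.
move=> [uv /= /and3P[/XY Yu /XY Yv uv_adj] puv].
by right; exists uv => //=; apply/and3P.
Qed.

Lemma sketch_drawing X : sketch X `<=` drawing_set D.
Proof.
move=> p [[v _ ->]|[[u v] /= /and3P[_ _ uv] puv]]; first by left; exists v.
by right; exists u, v.
Qed.

Lemma sketch_vertex X v : v \in X -> sketch X (pos D v).
Proof. by move=> Xv; left; exists v. Qed.

(** The ends of the arcs are counted as vertices, because the disjointness conditions of a drawing
    concern open arcs. *)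
Lemma sketchP X p : sketch X p -> (exists2 v, v \in X & p = pos D v) \/
  exists u v, [/\ u \in X, v \in X, adj u v & (arc D u v @` `]0, 1[) p].
Proof.
move=> [[v Xv ->]|[[u v] /= /and3P[Xu Xv uv] [t t01 <-]]]; first by left; exists v.
move: t01; rewrite /= in_itv /= => /andP[]; rewrite !le_eqVlt.
move=> /predU1P[<-|t0]; first by left; exists u; rewrite ?arc_start.
move=> /predU1P[->|t1]; first by left; exists v; rewrite ?arc_end.
by right; exists u, v; split=> //; exists t; rewrite //= in_itv /= t0.
Qed.

Lemma sketch_disjoint X Y : [disjoint X & Y]%B -> sketch X `&` sketch Y = set0.
Proof.
move=> dXY; have notboth v : v \in X -> v \in Y -> False.
  by move=> Xv; rewrite (disjointFr dXY Xv).
apply/seteqP; split=> // p [/sketchP[[v Xv pv]|[u [v [Xu Xv uv puv]]]]].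
  move=> /sketchP[[w Yw pw]|[x [y [_ _ xy pxy]]]].
    by rewrite pv in pw; move/pos_inj: pw => vw; apply: notboth Xv _; rewrite vw.
  by rewrite pv in pxy; exact: arc_avoids_vertices xy pxy.
move=> /sketchP[[w Yw pw]|[x [y [Yx Yy xy pxy]]]].
  by rewrite pw in puv; exact: arc_avoids_vertices uv puv.
have uvxy : [set u; v]%SET != [set x; y]%SET.
  apply/eqP => /setP/(_ u); rewrite !inE eqxx => /esym/orP[]/eqP h;
    by apply: notboth Xu _; rewrite h.
by rewrite -(arc_disjoint D uv xy uvxy).
Qed.

Lemma sketch_avoids X v : v \notin X -> ~ sketch X (pos D v).
Proof.
move=> Xv Xpv; suff : set0 (pos D v) by [].
rewrite -(@sketch_disjoint X [set v]%SET).
  by split=> //; apply: sketch_vertex; rewrite inE.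
by rewrite disjoint_sym disjoints1.
Qed.

Lemma edge_curve_joined u v : adj u v -> joined (edge_curve (u, v)) (pos D u) (pos D v).
Proof.
move=> uv d; apply: connected_chain.
- apply: connected_continuous_connected; first exact: segment_connected.
  exact: arc_continuous.
- by exists 0; rewrite ?arc_start //= in_itv /= lexx ler01.
- by exists 1; rewrite ?arc_end //= in_itv /= lexx ler01.
Qed.

Lemma sketch_joined X u v : connected_set X -> u \in X -> v \in X ->
  joined (sketch X) (pos D u) (pos D v).
Proof.
move=> [_ cX] Xu Xv; have [s [+ <- +]] := cX u v Xu Xv.
elim: s u {Xu Xv} => [|w s IH] u /=.
  move=> _ uX d _; exists [::] => //=; split=> //; apply: sketch_vertex.
  by apply: uX; exact: mem_head.
move=> /andP[uw ws] sX; apply: (@joined_trans _ _ _ (pos D w)); last first.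
  by apply: IH => // x xs; apply: sX; rewrite inE xs orbT.
apply: sub_joined (edge_curve_joined uw) => p puw; right; exists (u, w) => //=.
by apply/and3P; split=> //; apply: sX; rewrite !inE eqxx ?orbT.
Qed.

Variable F : set (R * R).
Hypotheses (outerF : is_outer_face D F) (onF : forall v, closure F (pos D v)).

Lemma sketch_unlinked X v : v \notin X -> unlinked (sketch X) (pos D v).
Proof.
move=> Xv; have [[p _ FE] Funb] := outerF.
apply: (@unlinked_unbounded _ _ F) => //; first exact: sketch_compact.
- by rewrite FE; exact: component_connected.
- apply/seteqP; split=> // q [Fq /sketch_drawing]; rewrite FE in Fq.
  exact: connected_component_sub Fq.
- exact: sketch_avoids.
Qed.

(** Each edge of K4 is represented by the sketch of the union of its two branch sets, and each
    vertex by a point of its branch set. *)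
Lemma outer_face_K4_free : ~ K4_minor G.
Proof.
move=> [A [B [C [E [[cA cB cC cE] [[AB AC AE] [BC BE CE]]]]]]].
have [[a Aa] [b Bb]] : (exists a, a \in A) /\ exists b, b \in B.
  by split; apply/set0Pn; [case: cA | case: cB].
have [[c Cc] [e Ee]] : (exists c, c \in C) /\ exists e, e \in E.
  by split; apply/set0Pn; [case: cC | case: cE].
have joinU X Y x y : connected_set X -> connected_set Y -> adj_blocks X Y ->
    x \in X -> y \in Y -> joined (sketch (X :|: Y)) (pos D x) (pos D y).
  move=> cX cY XY Xx Yy; apply: sketch_joined; first exact: connected_setU.
    by rewrite inE Xx.
  by rewrite inE Yy orbT.
have disj X Y : adj_blocks X Y -> X :&: Y = finset.set0.
  by move=> /andP[+ _]; rewrite -setI_eq0 => /eqP.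
have [dAB dAC dAE] := And3 (disj _ _ AB) (disj _ _ AC) (disj _ _ AE).
have [dBC dBE dCE] := And3 (disj _ _ BC) (disj _ _ BE) (disj _ _ CE).
have dis4 X Y Z W : X :&: Z = finset.set0 -> X :&: W = finset.set0 ->
    Y :&: Z = finset.set0 -> Y :&: W = finset.set0 ->
    sketch (X :|: Y) `&` sketch (Z :|: W) = set0.
  move=> XZ XW YZ YW; apply: sketch_disjoint.
  by rewrite -setI_eq0 finset.setIUr !finset.setIUl XZ XW YZ YW !finset.setU0.
(* All three sides lie in the sketch of the union of three branch sets, which does not contain the
   vertex [w] of the fourth. *)
have unl X Y (Z W : {set G}) w : w \in W -> X :&: W = finset.set0 ->
    Y :&: W = finset.set0 -> Z :&: W = finset.set0 ->
    unlinked (sketch (X :|: Y) `|` sketch (Y :|: Z) `|` sketch (X :|: Z)) (pos D w).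
  move=> Ww XW YW ZW; apply: (@sub_unlinked _ _ (sketch (X :|: Y :|: Z))); last first.
    apply: sketch_unlinked; apply/negP => h.
    have : w \in (X :|: Y :|: Z) :&: W by rewrite inE h.
    by rewrite !finset.setIUl XW YW ZW !finset.setU0 inE.
  by move=> p [[]|]; apply: subset_sketch; apply/fintype.subsetP => x;
    rewrite !inE => /orP[] ->; rewrite ?orbT.
apply: (@planar_radon R (pos D a) (pos D b) (pos D c) (pos D e) (sketch (A :|: B))
  (sketch (A :|: C)) (sketch (A :|: E)) (sketch (B :|: C)) (sketch (B :|: E))
  (sketch (C :|: E))).
- exact: joinU cA cB AB Aa Bb.
- exact: joinU cA cC AC Aa Cc.
- exact: joinU cA cE AE Aa Ee.
- exact: joinU cB cC BC Bb Cc.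
- exact: joinU cB cE BE Bb Ee.
- exact: joinU cC cE CE Cc Ee.
- exact: sketch_compact.
- exact: sketch_compact.
- exact: sketch_compact.
- exact: sketch_compact.
- exact: sketch_compact.
- exact: sketch_compact.
- exact: dis4.
- by apply: dis4; rewrite // finset.setIC.
- by apply: dis4; rewrite // finset.setIC.
- exact: unl Ee _ _ _.
- by apply: (unl _ _ _ _ _ Cc); rewrite // finset.setIC.
- by apply: (unl _ _ _ _ _ Bb); rewrite // finset.setIC.
- by apply: (unl _ _ _ _ _ Aa); rewrite // finset.setIC.
Qed.

End Sketch.

Theorem corollary21 (R : realType) (G : sgraph) (hconn : connected_graph G)
    (hout : outerplanar R G) (hiso : no_isolated G) :
  (chi_ON hiso <= 4)%N.
Proof.
have [D [F [outerF onF]]] := hout.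
have col4 := cfon_colorable4 (outer_face_K4_free outerF onF) hiso.
by rewrite /chi_ON; case: ex_minnP => k _; exact.
Qed.
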